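(* Let $G=\langle S \mid R\rangle$ and $G'=\langle S\mid R'\rangle$ be two (possibly infinite) presentations of groups with the same set of generators $S$. Let $R_0=R\cap R'$, $R_G=R\setminus R_0$, $R_{G'}=R'\setminus R_0$, and let $\pi_G:\langle S\rangle\to G$ be the projection map. If $\pi_G(R_{G'})\subset [G,G]$ and $H_1(G;\mathbb{Z})\cong H_1(G';\mathbb{Z})$, then $$a(G')\leq \# R_G + a(G).$$
   Context: $\langle S\rangle$ denotes the free group generated by the set $S$, and relators are regarded as elements of $\langle S\rangle$. For a group $G$, $[G,G]$ is the commutator subgroup and $H_1(G;\mathbb{Z})=G/[G,G]$ is the abelianization. The Ma-Qiu index $a(G)$ of a group $G$ is the minimum number of normal generators of the commutator subgroup $[G,G]$, that is, the minimum number of elements of $[G,G]$ whose normal closure in $G$ equals $[G,G]$. $\# R_G$ denotes the cardinality of $R_G$.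
   Formalization: For infinite S and an arbitrary abstract isomorphism the claim fails (e.g. F_3×Z^∞ versus F_2×Z^∞); the theorem assumes in addition that H_1(G;Z) is finitely generated (automatic for finite S) or that the isomorphism H_1(G)≅H_1(G') is the one induced by the identity of ⟨S⟩. *)

(* Defs.v *)
From HB Require Import structures.
From mathcomp Require Import all_boot.
From mathcomp Require Import boolp classical_sets functions cardinality.

Set Implicit Arguments.
Unset Strict Implicit.
Unset Printing Implicit Defensive.

Local Open Scope classical_set_scope.
Local Open Scope card_scope.
Local Open Scope quotient_scope.
Local Open Scope group_scope.

Section Subgroups.
Variable G : groupType.
Implicit Types (A H : set G) (x y : G).

Definition is_subgroup H : Prop :=
  H 1 /\ (forall x y, H x -> H y -> H (x * y^-1)).

Definition is_normal H : Prop :=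
  is_subgroup H /\ (forall x y, H x -> H (x ^ y)).

Definition generated A : set G := smallest is_subgroup A.

Definition normal_closure A : set G := smallest is_normal A.

Definition commutator_subgroup : set G :=
  generated [set z | exists x y, z = [~ x, y]].

Definition finitely_generated : Prop :=
  exists2 A : set G, finite_set A & generated A = setT.

Lemma generated_subgroup A : is_subgroup (generated A).
Proof.
split=> [B [[B1 _] _] //|x y Ax Ay B BA].
by case: (BA) => [[_ BM] _]; apply: BM; [apply: Ax | apply: Ay].
Qed.

Lemma normal_closure_normal A : is_normal (normal_closure A).
Proof.
split; [split=> [B [[[B1 _] _] _] //|x y Ax Ay B BA]|move=> x y Ax B BA].
  have [[[_ BD] _] _] := BA.
  exact: BD (Ax B BA) (Ay B BA).
have [[_ BJ] _] := BA.
exact: BJ (Ax B BA).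
Qed.

Lemma sub_normal_closure A : A `<=` normal_closure A.
Proof. by move=> x Ax B [_]; apply. Qed.

Lemma normal_closure_min A H : is_normal H -> A `<=` H -> normal_closure A `<=` H.
Proof. by move=> nH AH x; apply. Qed.

Lemma normal_closure_id H : is_normal H -> normal_closure H = H.
Proof.
by move=> nH; apply/seteqP; split;
  [apply: normal_closure_min | apply: sub_normal_closure].
Qed.

Lemma commutator_subgroup_normal : is_normal commutator_subgroup.
Proof.
split; first exact: generated_subgroup.
move=> x y; pose H := [set z | commutator_subgroup (z ^ y)].
have [c1 cM] := generated_subgroup [set z | exists x y, z = [~ x, y]].
move=> /(_ H); apply; split; first split.
- by rewrite /H /= conj1g; apply: c1.
- by move=> u v; rewrite /H /= conjMg conjVg; apply: cM.
by move=> _ [u [v ->]] B [_]; apply; exists (u ^ y), (v ^ y); rewrite conjRg.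
Qed.

End Subgroups.

Arguments commutator_subgroup : clear implicits.
Arguments finitely_generated : clear implicits.

Section Quotient.
Variables (G : groupType) (A : set G).
Implicit Types x y : G.

Definition quot_rel : rel G := fun x y => `[< normal_closure A (x * y^-1) >].

Let nA := normal_closure_normal A.
Let n1 : normal_closure A 1 := nA.1.1.
Let nD := nA.1.2.
Let nJ := nA.2.
Let nV x : normal_closure A x -> normal_closure A x^-1.
Proof. by move=> Ax; rewrite -[x^-1]mul1g; exact: nD n1 Ax. Qed.
Let nM x y : normal_closure A x -> normal_closure A y -> normal_closure A (x * y).
Proof. by move=> Ax Ay; rewrite -[y]invgK; exact: nD Ax (nV Ay). Qed.

Lemma quot_rel_refl : reflexive quot_rel.
Proof. by move=> x; apply/asboolP; rewrite mulgV. Qed.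

Lemma quot_rel_sym : symmetric quot_rel.
Proof. by move=> x y; apply/asboolP/asboolP => /nV; rewrite invgF. Qed.

Lemma quot_rel_trans : transitive quot_rel.
Proof.
move=> y x z /asboolP xy /asboolP yz; apply/asboolP.
by have := nM xy yz; rewrite mulgA mulgVK.
Qed.

Canonical quot_equiv := EquivRel quot_rel quot_rel_refl quot_rel_sym quot_rel_trans.

(* The quotient of G by the normal closure of A; when A is a normal subgroup
   this is G / A, see normal_closure_id. *)
Definition quotient_group : Type := {eq_quot quot_equiv}.

HB.instance Definition _ := Choice.on quotient_group.

Definition quot_proj x : quotient_group := \pi_({eq_quot quot_equiv}) x.

Let qrepr (u : quotient_group) : G := @repr _ {eq_quot quot_equiv} u.
Let qreprK u : quot_proj (qrepr u) = u.
Proof. exact: reprK. Qed.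

Lemma quot_projE x y :
  quot_proj x = quot_proj y <-> normal_closure A (x * y^-1).
Proof.
split=> [/(@eqmodP _ quot_equiv)/asboolP //|xy].
by apply/(@eqmodP _ quot_equiv)/asboolP.
Qed.

Definition quot_one := quot_proj 1.
Definition quot_mul (u v : quotient_group) := quot_proj (qrepr u * qrepr v).
Definition quot_inv (u : quotient_group) := quot_proj (qrepr u)^-1.

Let projM x y : quot_mul (quot_proj x) (quot_proj y) = quot_proj (x * y).
Proof.
apply/quot_projE; set x' := qrepr _; set y' := qrepr _.
have /quot_projE x'x : quot_proj x' = quot_proj x by rewrite qreprK.
have /quot_projE y'y : quot_proj y' = quot_proj y by rewrite qreprK.
have := nM x'x (nJ x^-1 y'y).
by rewrite /conjg invgK invgM !mulgA mulgVK.
Qed.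

Let projV x : quot_inv (quot_proj x) = quot_proj x^-1.
Proof.
apply/quot_projE; set x' := qrepr _.
have /quot_projE x'x : quot_proj x = quot_proj x' by rewrite qreprK.
by have := nJ x' x'x; rewrite /conjg invgK !mulgA mulgVK.
Qed.

Let mulA : associative quot_mul.
Proof.
move=> u v w; rewrite -(qreprK u) -(qreprK v) -(qreprK w).
by rewrite !projM mulgA.
Qed.
Let mul1 : left_id quot_one quot_mul.
Proof. by move=> u; rewrite -(qreprK u) projM mul1g. Qed.
Let mulr1 : right_id quot_one quot_mul.
Proof. by move=> u; rewrite -(qreprK u) projM mulg1. Qed.
Let mulV : left_inverse quot_one quot_inv quot_mul.
Proof. by move=> u; rewrite -(qreprK u) projV projM mulVg. Qed.
Let mulrV : right_inverse quot_one quot_inv quot_mul.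
Proof. by move=> u; rewrite -(qreprK u) projV projM mulgV. Qed.

HB.instance Definition _ :=
  isGroup.Build quotient_group mulA mul1 mulr1 mulV mulrV.

Let projM' : {morph quot_proj : x y / x * y}.
Proof. by move=> x y; rewrite -projM. Qed.
HB.instance Definition _ :=
  isMultiplicative.Build G quotient_group quot_proj projM'.
HB.instance Definition _ :=
  Multiplicative_isUMagmaMorphism.Build G quotient_group quot_proj erefl.

Lemma quot_proj_surj (u : quotient_group) : exists x, quot_proj x = u.
Proof. by exists (qrepr u); rewrite qreprK. Qed.

Lemma quot_proj_ker x : quot_proj x = 1 <-> normal_closure A x.
Proof. by rewrite (quot_projE x 1) invg1 mulg1. Qed.

End Quotient.

Section FreeGroup.
Variable S : Type.

(* A letter (s, false) stands for s and (s, true) for its inverse; classicType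
   merely equips S * bool with a choiceType structure. *)
Definition letter : Type := {classic S * bool}.
HB.instance Definition _ := Choice.on letter.
Definition inv_letter (a : letter) : letter := (a.1, ~~ a.2).

Inductive free_conv : seq letter -> seq letter -> Prop :=
| free_conv_refl w : free_conv w w
| free_conv_sym w1 w2 : free_conv w1 w2 -> free_conv w2 w1
| free_conv_trans w2 w1 w3 : free_conv w1 w2 -> free_conv w2 w3 -> free_conv w1 w3
| free_conv_cancel u a v : free_conv (u ++ a :: inv_letter a :: v) (u ++ v).

Definition free_rel : rel (seq letter) := fun u v => `[< free_conv u v >].

Lemma free_rel_refl : reflexive free_rel.
Proof. by move=> w; apply/asboolP/free_conv_refl. Qed.

Lemma free_rel_sym : symmetric free_rel.
Proof. by move=> u v; apply/asboolP/asboolP => /free_conv_sym. Qed.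

Lemma free_rel_trans : transitive free_rel.
Proof.
by move=> v u w /asboolP uv /asboolP vw; apply/asboolP/(free_conv_trans uv vw).
Qed.

Canonical free_equiv := EquivRel free_rel free_rel_refl free_rel_sym free_rel_trans.

Definition free_group : Type := {eq_quot free_equiv}.

HB.instance Definition _ := Choice.on free_group.

Definition free_class (w : seq letter) : free_group := \pi_({eq_quot free_equiv}) w.

Definition free_gen (s : S) : free_group := free_class [:: (s, false) : letter].

Let frepr (u : free_group) : seq letter := @repr _ {eq_quot free_equiv} u.
Let freprK u : free_class (frepr u) = u.
Proof. exact: reprK. Qed.

Lemma free_classE u v : free_class u = free_class v <-> free_conv u v.
Proof.
split=> [/(@eqmodP _ free_equiv)/asboolP //|uv].
by apply/(@eqmodP _ free_equiv)/asboolP.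
Qed.

Definition inv_word (w : seq letter) := rev (map inv_letter w).

Definition free_one := free_class [::].
Definition free_mul (u v : free_group) := free_class (frepr u ++ frepr v).
Definition free_inv (u : free_group) := free_class (inv_word (frepr u)).

Let inv_letterK : involutive inv_letter.
Proof. by move=> [s b]; rewrite /inv_letter /= negbK. Qed.

Let conv_cat u u' v v' :
  free_conv u u' -> free_conv v v' -> free_conv (u ++ v) (u' ++ v').
Proof.
move=> uu' vv'; apply: (@free_conv_trans (u' ++ v)).
  elim: uu' => {u u'} [u|u u' _ /free_conv_sym//|w u u' _ IH1 _|u a w].
  - exact: free_conv_refl.
  - exact: free_conv_trans.
  by rewrite -!catA /=; apply: free_conv_cancel.
elim: vv' => {v v'} [v|v v' _ /free_conv_sym//|w v v' _ IH1 _|v a w].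
- exact: free_conv_refl.
- exact: free_conv_trans.
by rewrite !catA; apply: free_conv_cancel.
Qed.

Let conv_inv u v : free_conv u v -> free_conv (inv_word u) (inv_word v).
Proof.
elim=> {u v} [u|u v _ /free_conv_sym//|w u v _ IH1 _|u a w].
- exact: free_conv_refl.
- exact: free_conv_trans.
rewrite /inv_word !map_cat !rev_cat /= !rev_cons -!cats1 -!catA /= inv_letterK.
exact: free_conv_cancel.
Qed.

Let conv_mulV w : free_conv (w ++ inv_word w) [::].
Proof.
elim: w => [|a w IH]; first exact: free_conv_refl.
rewrite /inv_word /= rev_cons -cats1 catA.
apply: free_conv_trans (free_conv_cancel [::] a [::]).
exact: (conv_cat (conv_cat (free_conv_refl [:: a]) IH) (free_conv_refl _)).
Qed.

Let inv_wordK : involutive inv_word.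
Proof.
by move=> w; rewrite /inv_word map_rev revK -map_comp map_id_in // => a _ /=.
Qed.

Let classM u v : free_mul (free_class u) (free_class v) = free_class (u ++ v).
Proof. by apply/free_classE/conv_cat; apply/free_classE; rewrite freprK. Qed.

Let classV u : free_inv (free_class u) = free_class (inv_word u).
Proof. by apply/free_classE/conv_inv; apply/free_classE; rewrite freprK. Qed.

Let mulA : associative free_mul.
Proof.
move=> u v w; rewrite -(freprK u) -(freprK v) -(freprK w).
by rewrite !classM catA.
Qed.
Let mul1 : left_id free_one free_mul.
Proof. by move=> u; rewrite -(freprK u) classM. Qed.
Let mulr1 : right_id free_one free_mul.
Proof. by move=> u; rewrite -(freprK u) classM cats0. Qed.
Let mulrV : right_inverse free_one free_inv free_mul.
Proof. by move=> u; rewrite -(freprK u) classV classM; apply/free_classE. Qed.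
Let mulV : left_inverse free_one free_inv free_mul.
Proof.
move=> u; rewrite -(freprK u) classV classM; apply/free_classE.
by rewrite -{2}[frepr u]inv_wordK; apply: conv_mulV.
Qed.

HB.instance Definition _ := isGroup.Build free_group mulA mul1 mulr1 mulV mulrV.

Lemma free_class_cat u v : free_class (u ++ v) = free_class u * free_class v.
Proof. by rewrite -classM. Qed.

Lemma free_class_inv u : free_class (inv_word u) = (free_class u)^-1.
Proof. by rewrite -classV. Qed.

Lemma free_class_surj (u : free_group) : exists w, free_class w = u.
Proof. by exists (frepr u); rewrite freprK. Qed.

Section UniversalProperty.
Variables (H : groupType) (f : S -> H).

Definition letter_eval (a : letter) : H := if a.2 then (f a.1)^-1 else f a.1.
Definition word_eval (w : seq letter) : H := \prod_(a <- w) letter_eval a.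
Definition free_lift (u : free_group) : H := word_eval (frepr u).

Lemma word_eval_conv u v : free_conv u v -> word_eval u = word_eval v.
Proof.
elim=> {u v} [//|u v _ -> //|w u v _ -> _ -> //|u [s b] v].
rewrite /word_eval !big_cat /= !big_cons /letter_eval /=.
by case: b; rewrite /= ?mulKg ?mulVKg.
Qed.

Lemma free_lift_class w : free_lift (free_class w) = word_eval w.
Proof. by apply: word_eval_conv; apply/free_classE; rewrite freprK. Qed.

Lemma free_lift1 : free_lift 1 = 1.
Proof. by rewrite free_lift_class /word_eval big_nil. Qed.

Lemma free_liftM : {morph free_lift : u v / u * v}.
Proof.
move=> u v; rewrite -(freprK u) -(freprK v) -free_class_cat.
by rewrite !free_lift_class /word_eval big_cat.
Qed.
HB.instance Definition _ :=
  isMultiplicative.Build free_group H free_lift free_liftM.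
HB.instance Definition _ :=
  Multiplicative_isUMagmaMorphism.Build free_group H free_lift free_lift1.

Lemma free_lift_gen s : free_lift (free_gen s) = f s.
Proof. by rewrite free_lift_class /word_eval big_seq1. Qed.

Lemma free_lift_unique (g : {multiplicative free_group -> H}) :
  (forall s, g (free_gen s) = f s) -> g =1 free_lift.
Proof.
move=> gf u; have g1 : g 1 = 1 by apply: (mulgI (g 1)); rewrite -gmulfM !mulg1.
have [w <-] := free_class_surj u; rewrite free_lift_class.
elim: w => [|a w IH]; first by rewrite /word_eval big_nil.
rewrite -cat1s free_class_cat gmulfM IH /word_eval big_cat big_seq1 /=.
congr (_ * _); rewrite /letter_eval; case: a => s [] /=; last exact: gf.
rewrite -(gf s); apply: (mulIg (g (free_gen s))); rewrite mulVg -gmulfM -g1.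
by rewrite -[free_class _]/(free_class (inv_word [:: (s, false) : letter]))
  free_class_inv mulVg.
Qed.

End UniversalProperty.
End FreeGroup.

Definition presented_group (S : Type) (R : set (free_group S)) : groupType :=
  quotient_group R.

Definition pres_proj (S : Type) (R : set (free_group S)) :
  free_group S -> presented_group R := @quot_proj _ R.
HB.instance Definition _ S R :=
  UMagmaMorphism.copy (@pres_proj S R) (@quot_proj _ R).

Definition H1 (G : groupType) : groupType :=
  quotient_group (commutator_subgroup G).

Definition ab_proj (G : groupType) : G -> H1 G :=
  @quot_proj _ (commutator_subgroup G).
HB.instance Definition _ G :=
  UMagmaMorphism.copy (@ab_proj G) (@quot_proj _ (commutator_subgroup G)).

Arguments pres_proj {S} R.

Lemma ab_proj_ker (G : groupType) (x : G) :
  ab_proj x = 1 <-> commutator_subgroup G x.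
Proof.
have := quot_proj_ker (commutator_subgroup G) x.
by rewrite normal_closure_id //; apply: commutator_subgroup_normal.
Qed.

Lemma finite_gen_H1 (S : Type) (R : set (free_group S)) :
  finite_set [set: S] -> finitely_generated (H1 (presented_group R)).
Proof.
move=> finS; pose p (u : free_group S) := ab_proj (pres_proj R u).
exists [set p (free_gen s) | s in [set: S]]; first exact: finite_image.
apply/seteqP; split=> // z _.
have [y <-] := quot_proj_surj z; have [x <-] := quot_proj_surj y.
rewrite -[quot_proj _ _]/(p x).
have [w <-] := free_class_surj x => B [[B1 BD] genB].
have BV u : B u -> B u^-1 by move=> Bu; rewrite -[u^-1]mul1g; apply: BD.
have BM u v : B u -> B v -> B (u * v).
  by move=> Bu Bv; rewrite -[v]invgK; apply/BD/BV.
have pM u v : p (u * v) = p u * p v by rewrite /p !gmulfM.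
have pV u : p u^-1 = (p u)^-1 by rewrite /p !gmulfV.
have p1 : p 1 = 1 by rewrite /p !gmulf1.
elim: w => [|[s b] w IH]; first by rewrite -[free_class _]/(1 : free_group S) p1.
rewrite -cat1s free_class_cat pM; apply: BM => //.
case: b; last by apply: genB; exists s.
rewrite -[free_class _]/(free_class (inv_word [:: (s, false) : letter S])).
by rewrite free_class_inv pV; apply/BV/genB; exists s.
Qed.

(* Well-foundedness of cardinals: Zorn's lemma gives a maximal set Phi of choice
   functions on F that are pairwise distinct at every member of F, and Phi must
   exhaust some member A of F. *)
Lemma card_min_exists (T : Type) (F : set (set T)) :
  F !=set0 -> exists2 A, F A & forall B, F B -> A #<= B.
Proof.
move=> [A0 FA0].
pose P := [set Phi : set (set T -> T) |
  (forall phi, Phi phi -> forall B, F B -> B (phi B)) /\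
  (forall phi psi, Phi phi -> Phi psi ->
     forall B, F B -> phi B = psi B -> phi = psi)].
have [C CP totC|Phi [[PhiF Phi_inj] Phi_max]] := @Zorn_bigcup _ P.
  split=> [phi [X CX Xphi]|phi psi [X CX Xphi] [Y CY Ypsi]].
    by have [+ _] := CP _ CX; apply.
  have [XY|YX] := totC _ _ CX CY.
    by have [_] := CP _ CY; apply=> //; apply: XY.
  by have [_] := CP _ CX; apply=> //; apply: YX.
have [A FA sA] : exists2 A, F A & A `<=` [set phi A | phi in Phi].
  apply: contrapT => noA.
  have new B : F B -> exists2 x, B x & forall phi, Phi phi -> phi B <> x.
    move=> FB; apply: contrapT => noB; apply: noA; exists B => // x Bx.
    by apply: contrapT => nx; apply: noB; exists x => // phi Pphi pE;
      apply: nx; exists phi.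
  have [x0 _ _] := new _ FA0.
  have /choice[chi chiP] : forall B, exists x,
      F B -> B x /\ forall phi, Phi phi -> phi B <> x.
    move=> B; have [FB|nFB] := pselect (F B); last by exists x0.
    by have [x Bx nx] := new _ FB; exists x.
  have nchi : ~ Phi chi by move=> Pchi; have [_ /(_ _ Pchi)] := chiP _ FA0.
  apply: (Phi_max (Phi `|` [set chi])).
    by split=> [psi Ppsi|sub]; [left | apply/nchi/sub; right].
  split=> [phi [Pphi|->] B FB|phi psi [Pphi|->] [Ppsi|->] B FB //].
  - exact: PhiF Pphi B FB.
  - by have [] := chiP _ FB.
  - exact: Phi_inj Pphi Ppsi B FB.
  - by move=> E; have [_ /(_ _ Pphi)] := chiP _ FB.
  - by move=> E; have [_ /(_ _ Ppsi)] := chiP _ FB; rewrite E.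
exists A => // B FB.
apply: card_le_trans (subset_card_le sA) _.
apply: card_le_trans (card_image_le _ _) _.
have injB : {in Phi &, injective (fun phi => phi B)}.
  by move=> phi psi /set_mem Pphi /set_mem Ppsi; apply: Phi_inj Pphi Ppsi B FB.
rewrite -(card_le_eql (inj_card_eq injB)).
by apply: subset_card_le => _ [phi Pphi <-]; exact: PhiF Pphi B FB.
Qed.

Definition normally_generates (G : groupType) (A : set G) : Prop :=
  A `<=` commutator_subgroup G /\ normal_closure A = commutator_subgroup G.

Definition is_min_normal_generating (G : groupType) (A : set G) : Prop :=
  normally_generates A /\ forall B : set G, normally_generates B -> A #<= B.

Lemma min_normal_generating_exists (G : groupType) :
  exists A : set G, is_min_normal_generating A.
Proof.
have [|A nA Amin] := @card_min_exists G [set A | normally_generates A].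
  exists (commutator_subgroup G); split=> //.
  exact: normal_closure_id (@commutator_subgroup_normal G).
by exists A.
Qed.

(* a(G) is a possibly infinite cardinal. It is represented by a set having that
   cardinality, namely a normally generating set of least cardinality. *)
Definition ma_qiu_index (G : groupType) : set G :=
  sval (cid (min_normal_generating_exists G)).

Arguments ma_qiu_index : clear implicits.

Lemma ma_qiu_indexP (G : groupType) : is_min_normal_generating (ma_qiu_index G).
Proof. exact: svalP. Qed.

Lemma ma_qiu_index_unique (G : groupType) (A : set G) :
  is_min_normal_generating A -> A #= ma_qiu_index G.
Proof.
move=> [nA Amin]; have [nG Gmin] := ma_qiu_indexP G.
by rewrite card_eq_le Amin ?Gmin.
Qed.

(* Disjoint union, representing the sum of two cardinals. *)
Definition set_sum (T U : Type) (A : set T) (B : set U) : set (T + U) :=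
  [set z | match z with inl x => A x | inr y => B y end].

(* Main.v *)
Require Import Defs.
From HB Require Import structures.
From mathcomp Require Import all_boot all_algebra.
From mathcomp Require Import boolp classical_sets functions cardinality.

(** Write F for the free group on S and N, N' for the normal closures of R and
    R', so that H_1(G) = F / N[F,F] and H_1(G') = F / N'[F,F].

    The relators of G' that are not relators of G lie in N[F,F] by hypothesis,
    hence so does N', and the identity of F induces a surjection from H_1(G') to
    H_1(G) (h1_class_ker_sub).  It is an isomorphism.  This is immediate when
    the given isomorphism is compatible with the generators.  Otherwise H_1(G)
    is a finitely generated abelian group; composing the surjection with the
    given isomorphism yields a surjective endomorphism, which is injective
    because such groups are Hopfian (fg_abelian_hopfian, fg_abelian_epi_ker).
    So N[F,F] = N'[F,F], and in particular the relators in R \ R' map into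
    [G',G'].

    The inequality follows by exhibiting normal generators of [G',G']
    (ma_qiu_index_le).  Lift a least set A of normal generators of [G,G] to
    [F,F], and take in G' the images of these lifts and of R \ R'.  All of them
    lie in [G',G'].  Conversely, the preimage K in F of their normal closure
    contains R' and R \ R', hence N; as it also contains lifts of A, its image
    in G contains [G,G], and so K contains N[F,F] = N'[F,F], the preimage of
    [G',G']. *)

Set Implicit Arguments.
Unset Strict Implicit.
Unset Printing Implicit Defensive.

Local Open Scope classical_set_scope.
Local Open Scope card_scope.

(** * Finitely generated abelian groups are Hopfian *)

Section IntegerCombinations.
Import GRing.Theory.
Local Open Scope ring_scope.
Variables (M : zmodType) (n : nat) (m : 'I_n -> M).

Definition int_comb (c : 'rV[int]_n) : M := \sum_j m j *~ c 0 j.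

Lemma int_comb_is_zmod_morphism : zmod_morphism int_comb.
Proof.
move=> c d; rewrite /int_comb -sumrB; apply: eq_bigr => j _.
by rewrite !mxE mulrzBr.
Qed.
HB.instance Definition _ :=
  GRing.isZmodMorphism.Build 'rV[int]_n M int_comb int_comb_is_zmod_morphism.

Lemma int_combZ k (c : 'rV[int]_n) : int_comb (k *: c) = int_comb c *~ k.
Proof.
rewrite /int_comb mulrz_suml; apply: eq_bigr => j _.
by rewrite mxE mulrC mulrzA.
Qed.

Lemma int_comb_delta j : int_comb (delta_mx 0 j) = m j.
Proof.
rewrite /int_comb (bigD1 j) //= mxE !eqxx big1 ?addr0 // => i nij.
by rewrite mxE (negPf nij) andbF.
Qed.

End IntegerCombinations.

Section Hopfian.
Import GRing.Theory.
Local Open Scope ring_scope.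

(** Surjectivity writes each generator as phi of an integer combination of the
    generators.  Collecting the coefficients in a square matrix A makes the
    action of A on coefficient vectors a section of phi at the level of
    combinations: phi (comb (c A)) = comb c.  If chi is the characteristic
    polynomial of A, of degree d, then phi^d (comb (c chi(A))) vanishes by
    Cayley-Hamilton, while its expansion is the sum over i of
    chi_i phi^(d - i) (comb c).  When phi (comb c) = 0 only the leading term
    i = d survives, and it is comb c because chi is monic. *)
Lemma zmod_hopfian (M : zmodType) (n : nat) (m : 'I_n -> M)
    (phi : {additive M -> M}) :
    (forall x, exists c, x = int_comb m c) ->
    (forall y, exists x, phi x = y) ->
  forall x, phi x = 0 -> x = 0.
Proof.
case: n m => [|n] m span surj x.
  by have [c ->] := span x; rewrite /int_comb big_ord0.
have /choice[a aP] i : exists a, phi (int_comb m a) = m i.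
  by have [y <-] := surj (m i); have [c ->] := span y; exists c.
pose A : 'M[int]_n.+1 := \matrix_i a i.
have phiA c : phi (int_comb m (c *m A)) = int_comb m c.
  rewrite mulmx_sum_row (raddf_sum (int_comb m)) raddf_sum.
  by apply: eq_bigr => i _ /=; rewrite int_combZ raddfMz rowK aP.
have phiAX i c : iter i phi (int_comb m (c *m A ^+ i)) = int_comb m c.
  elim: i c => [|i IH] c; first by rewrite expr0 mulmx1.
  by rewrite exprSr mulmxA iterSr phiA IH.
have [c ->] := span x => phic.
have iter0 i : iter i phi 0 = 0 by elim: i => //= i ->; rewrite raddf0.
have killed i k : (i < k)%N -> iter k phi (int_comb m (c *m A ^+ i)) = 0.
  by move/subnK <-; rewrite addnS -addSn iterD phiAX iterSr phic iter0.
have iterB i : {morph iter i phi : u v / u - v}.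
  by elim: i => // i IH u v; rewrite !iterS IH raddfB.
have [psi psiE] : exists psi : {additive M -> M}, psi =1 iter n.+1 phi.
  by exists (HB.pack_for {additive M -> M} (iter n.+1 phi)
    (GRing.isZmodMorphism.Build M M (iter n.+1 phi) (iterB n.+1))).
have : psi (int_comb m (c *m horner_mx A (char_poly A))) = 0.
  by rewrite Cayley_Hamilton mulmx0 !raddf0.
rewrite -[X in horner_mx A X]coefK poly_def rmorph_sum size_char_poly.
rewrite mulmx_sumr (raddf_sum (int_comb m)) raddf_sum big_ord_recr /=.
have termE i : psi (int_comb m (c *m horner_mx A ((char_poly A)`_i *: 'X^i))) =
    psi (int_comb m (c *m A ^+ i)) *~ (char_poly A)`_i.
  by rewrite linearZ rmorphXn /= horner_mx_X -scalemxAr int_combZ raddfMz.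
rewrite big1 => [|i _]; last by rewrite termE psiE killed ?mul0rz.
have lead1 : (char_poly A)`_n.+1 = 1.
  by have := monicP (char_poly_monic A); rewrite lead_coefE size_char_poly.
by rewrite termE add0r psiE phiAX lead1.
Qed.
End Hopfian.

Local Open Scope group_scope.

(** * Transfer to multiplicative groups *)

Section AdditiveNotation.
Variables (G : groupType) (GC : forall x y : G, commute x y).

(** A copy of G whose dependence on the proof of commutativity lets the
    additive structure be inferred from the type alone. *)
Definition additive_of of (forall x y : G, commute x y) : Type := G.
HB.instance Definition _ := Choice.on (additive_of GC).
HB.instance Definition _ :=
  GRing.isZmodule.Build (additive_of GC) mulgA GC mul1g mulVg.

End AdditiveNotation.

Lemma fg_abelian_hopfian (A : groupType) (phi : A -> A) :
    (forall x y : A, commute x y) -> finitely_generated A ->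
    {morph phi : x y / x * y} -> (forall y, exists x, phi x = y) ->
  forall x, phi x = 1 -> x = 1.
Proof.
move=> AC [X /finite_seqP[s ->] gens] phiM surj.
pose M := additive_of AC; pose m (i : 'I_(size s)) : M := nth 1 s i.
have phi1 : phi 1 = 1 by apply: (mulgI (phi 1)); rewrite -phiM !mulg1.
have phiV x : phi x^-1 = (phi x)^-1.
  by apply: (mulgI (phi x)); rewrite -phiM !mulgV.
have phiB : GRing.zmod_morphism (phi : M -> M).
  by move=> x y; rewrite [LHS]phiM phiV.
pose psi : {additive M -> M} := HB.pack_for {additive M -> M} (phi : M -> M)
  (GRing.isZmodMorphism.Build M M phi phiB).
apply: (@zmod_hopfian M _ m psi _ surj) => x.
have : generated [set` s] (x : A) by rewrite gens.
move=> /(_ [set y : A | exists c, (y : M) = int_comb m c]); apply.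
split; first split.
- by exists 0%R; rewrite GRing.Theory.raddf0.
- by move=> _ _ [c ->] [d ->]; exists (c - d)%R; rewrite GRing.Theory.raddfB.
move=> y; rewrite /= => sy.
have sy' : (index y s < size s)%N by rewrite index_mem.
by exists (delta_mx 0%R (Ordinal sy')); rewrite int_comb_delta /m nth_index.
Qed.

(** The inclusion of the kernel of q in that of p makes p factor through q, by a
    surjective endomorphism of A, to which the Hopf property applies. *)
Lemma fg_abelian_epi_ker (F A : groupType) (p q : UMagmaMorphism.type F A) :
    (forall x y : A, commute x y) -> finitely_generated A ->
    (forall a, exists w, p w = a) -> (forall a, exists w, q w = a) ->
    (forall w, q w = 1 -> p w = 1) ->
  forall w, p w = 1 -> q w = 1.
Proof.
move=> AC Afg psurj /choice[s qs] qp w pw.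
have factor v : p (s (q v)) = p v.
  have : q (s (q v) * v^-1) = 1 by rewrite gmulfM gmulfV qs mulgV.
  by move/qp; rewrite gmulfM gmulfV => /divg1_eq.
apply: (@fg_abelian_hopfian A (p \o s)) => //=; last by rewrite factor.
- move=> x y; have -> : x * y = q (s x * s y) by rewrite gmulfM !qs.
  by rewrite /= factor gmulfM.
- by move=> y; have [v <-] := psurj y; exists (q v); rewrite factor.
Qed.

(** * Normal subgroups and commutators under morphisms *)

Section NormalSubgroups.
Variables (G H : groupType) (f : UMagmaMorphism.type G H).

Lemma preimage_normal (K : set H) : is_normal K -> is_normal (f @^-1` K).
Proof.
move=> [[K1 KD] KJ]; split; first split=> [|x y Kx Ky] /=.
- by rewrite gmulf1.
- by rewrite gmulfM gmulfV; apply: KD.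
by move=> x y Kx /=; rewrite gmulfJ; apply: KJ.
Qed.

Lemma kernel_normal : is_normal [set x | f x = 1].
Proof.
apply: (@preimage_normal [set 1]); split; first split=> // x y -> ->.
  by rewrite /= mulgV.
by move=> x y ->; rewrite /= conj1g.
Qed.

Lemma image_normal (K : set G) :
  (forall y, exists x, f x = y) -> is_normal K -> is_normal (f @` K).
Proof.
move=> surj [[K1 KD] KJ]; split; first split=> [|_ _ [x Kx <-] [y Ky <-]].
- by exists 1; rewrite ?gmulf1.
- by exists (x * y^-1); [apply: KD | rewrite gmulfM gmulfV].
by move=> _ y [x Kx <-]; have [z <-] := surj y; exists (x ^ z);
  [apply: KJ | rewrite gmulfJ].
Qed.

Lemma commutator_subgroup_morph x :
  commutator_subgroup G x -> commutator_subgroup H (f x).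
Proof.
have [subH _] := preimage_normal (@commutator_subgroup_normal H).
move=> /(_ (f @^-1` commutator_subgroup H)); apply; split=> // _ [u [v ->]] /=.
by rewrite gmulfR => B [_]; apply; exists (f u), (f v).
Qed.

Lemma commutator_subgroup_lift y :
    (forall y, exists x, f x = y) -> commutator_subgroup H y ->
  exists2 x, commutator_subgroup G x & f x = y.
Proof.
move=> surj.
have [subH _] := image_normal surj (@commutator_subgroup_normal G).
move=> /(_ (f @` commutator_subgroup G)) [|x Dx fx]; last by exists x.
split=> // _ [u [v ->]].
have [[a <-] [b <-]] := (surj u, surj v); exists [~ a, b]; last exact: gmulfR.
by move=> B [_]; apply; exists a, b.
Qed.

Lemma commutator_subgroup_abelian_ker x :
  (forall x y : H, commute x y) -> commutator_subgroup G x -> f x = 1.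
Proof.
move=> HC; have [kerf _] := kernel_normal.
move=> /(_ [set x | f x = 1]); apply; split=> // _ [u [v ->]] /=; rewrite gmulfR.
by apply/eqP/commgP/HC.
Qed.

End NormalSubgroups.

(** * Comparison of the two presentations *)

Lemma H1_abelian (G : groupType) (x y : H1 G) : commute x y.
Proof.
have [[u <-] [v <-]] := (quot_proj_surj x, quot_proj_surj y).
apply/commgP/eqP; rewrite -gmulfR; apply/ab_proj_ker => B [_]; apply.
by exists u, v.
Qed.

Lemma pres_proj_relator (S : Type) (R : set (free_group S)) r :
  R r -> pres_proj R r = 1.
Proof. by move=> Rr; apply: (quot_proj_ker _ _).2 (sub_normal_closure Rr). Qed.

Section Presentations.
Variables (S : Type) (R R' : set (free_group S)).
Let G := presented_group R.
Let G' := presented_group R'.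

Definition h1_class (Q : set (free_group S)) (w : free_group S) :
  H1 (presented_group Q) := ab_proj (pres_proj Q w).
HB.instance Definition _ Q :=
  UMagmaMorphism.copy (h1_class Q) (@ab_proj _ \o pres_proj Q).

Lemma h1_class_surj Q (u : H1 (presented_group Q)) :
  exists w, h1_class Q w = u.
Proof.
have [x <-] := quot_proj_surj u; have [w <-] := quot_proj_surj x.
by exists w.
Qed.

(** An element of F that dies in H_1(G') is, modulo the normal closure of R',
    a product of commutators; both parts die in H_1(G). *)
Lemma h1_class_ker_sub :
    (forall r, R' r -> h1_class R r = 1) ->
  forall w, h1_class R' w = 1 -> h1_class R w = 1.
Proof.
move=> R'1 w /ab_proj_ker /(commutator_subgroup_lift (@quot_proj_surj _ R')).
move=> [d Dd /quot_projE].
move/(normal_closure_min (kernel_normal (h1_class R)) R'1).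
rewrite /= gmulfM gmulfV (commutator_subgroup_abelian_ker _ _ Dd).
  by rewrite mul1g => /eqP; rewrite invg_eq1 => /eqP.
exact: H1_abelian.
Qed.

(** The images of RG and of lifts to [F,F] of normal generators of [G,G]
    normally generate [G',G']: the lifts are chosen in [F,F] so that they land
    in [G',G'], and ker' is what pulls [G',G'] back to the preimage of
    [G,G]. *)
Lemma ma_qiu_index_le (RG : set (free_group S)) :
    R `<=` R' `|` RG ->
    (forall w, h1_class R' w = 1 -> h1_class R w = 1) ->
    (forall r, RG r -> h1_class R' r = 1) ->
  ma_qiu_index G' #<= set_sum RG (ma_qiu_index G).
Proof.
move=> subR ker' RG1; have [[A_comm A_gen] _] := ma_qiu_indexP G.
set A := ma_qiu_index G in A_comm A_gen *.
have /choice[lift liftP] a : exists d, A a ->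
    commutator_subgroup (free_group S) d /\ pres_proj R d = a.
  have [Aa|nA] := pselect (A a); last by exists 1.
  have [d Dd da] :=
    commutator_subgroup_lift (@quot_proj_surj _ R) (A_comm _ Aa).
  by exists d.
pose gen (z : free_group S + G) : G' :=
  pres_proj R' (match z with inl r => r | inr a => lift a end).
suff gens : normally_generates (gen @` set_sum RG A).
  have [_ minG'] := ma_qiu_indexP G'.
  exact: card_le_trans (minG' _ gens) (card_image_le _ _).
have gens_comm : gen @` set_sum RG A `<=` commutator_subgroup G'.
  move=> _ [[r|a] /= Hz <-]; first exact/ab_proj_ker/RG1.
  by apply: commutator_subgroup_morph; have [] := liftP _ Hz.
split=> //; apply/seteqP; split.
  exact: normal_closure_min (@commutator_subgroup_normal G') gens_comm.
set N := normal_closure _.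
have nN : is_normal N := normal_closure_normal _.
have nK : is_normal (pres_proj R' @^-1` N) := preimage_normal _ nN.
have RK : normal_closure R `<=` pres_proj R' @^-1` N.
  apply: normal_closure_min => // r /subR[R'r|RGr] /=.
    by rewrite pres_proj_relator //; case: nN => [[]].
  by apply: sub_normal_closure; exists (inl r).
have GK : commutator_subgroup G `<=` pres_proj R @` (pres_proj R' @^-1` N).
  rewrite -A_gen; apply: normal_closure_min.
    exact: image_normal (@quot_proj_surj _ R) nK.
  move=> a Aa; have [_ da] := liftP _ Aa; exists (lift a) => //.
  by apply: sub_normal_closure; exists (inr a).
move=> z; have [w <-] := quot_proj_surj z => /ab_proj_ker/ker'/ab_proj_ker/GK.
move=> [k Kk /quot_projE/RK] kw.
have [[K1 KD] _] := nK.
(* w = (k / w)^-1 / k^-1 *)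
have := KD _ _ (KD _ _ K1 kw) (KD _ _ K1 Kk).
by rewrite !mul1g invgM !invgK mulgVK.
Qed.

End Presentations.

Theorem theorem1 (S : Type) (R R' : set (free_group S)) :
  let G := presented_group R in
  let G' := presented_group R' in
  let R0 := R `&` R' in
  let RG := R `\` R0 in
  let RG' := R' `\` R0 in
  [set pres_proj R r | r in RG'] `<=` commutator_subgroup G ->
  (exists f : {multiplicative H1 G -> H1 G'},
     bijective f /\
     (finitely_generated (H1 G) \/
      forall w : free_group S,
        f (ab_proj (pres_proj R w)) = ab_proj (pres_proj R' w))) ->
  ma_qiu_index G' #<= set_sum RG (ma_qiu_index G).
Proof.
move=> G G' R0 RG RG' RG'_comm [f [[g fK gK] H1iso]].
have Rker r : R r -> h1_class R r = 1.
  by move=> Rr; rewrite /h1_class pres_proj_relator // gmulf1.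
have ker' : forall w, h1_class R' w = 1 -> h1_class R w = 1.
  apply: h1_class_ker_sub => r R'r; have [Rr|nRr] := pselect (R r).
    exact: Rker.
  by apply/ab_proj_ker; apply: RG'_comm; exists r => //; split=> // -[].
suff ker w : h1_class R w = 1 -> h1_class R' w = 1.
  apply: ma_qiu_index_le => // [r Rr|r [Rr _]]; last exact/ker/Rker.
  have [R'r|nR'r] := pselect (R' r); [by left | right].
  by split=> // -[].
have f1 : f 1 = 1 by apply: (mulgI (f 1)); rewrite -gmulfM !mulg1.
have g1 : g 1 = 1 by rewrite -f1 fK.
case: H1iso => [fgH1|f_ind] wR; last first.
  by rewrite /h1_class -f_ind -f1 -wR.
have gM := can2_gmulfM fK gK.
(* Transporting the class in H_1(G') through g gives two epimorphisms onto the
   same group H_1(G). *)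
pose q : free_group S -> H1 G := g \o h1_class R'.
have qM : {morph q : x y / x * y} by move=> x y; rewrite /q /= gmulfM gM.
have q1 : q 1 = 1 by rewrite /q /= gmulf1 g1.
pose qm : UMagmaMorphism.type (free_group S) (H1 G) :=
  HB.pack_for (UMagmaMorphism.type (free_group S) (H1 G)) q
    (isMultiplicative.Build _ _ q qM)
    (Multiplicative_isUMagmaMorphism.Build _ _ q q1).
have qE v : q v = 1 <-> h1_class R' v = 1.
  split=> [qv|R'v]; last by rewrite /q /= R'v.
  by apply: (can_inj gK); rewrite g1.
apply/qE; apply: (@fg_abelian_epi_ker _ _ (h1_class R) qm) wR => //.
- exact: H1_abelian.
- exact: h1_class_surj.
- move=> a; have [v va] := h1_class_surj (f a); exists v.
  by rewrite /= /q /= va fK.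
- by move=> v /qE/ker'.
Qed.
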